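(* Let $M=B\times_{b_1}F_1\times\cdots\times_{b_m}F_m$ be a multiply warped product with $\dim B=n$, such that each fiber $F_i$, of dimension $s_i$, is Einstein with scalar curvature $\tau_{F_i}=s_i\mu_i$, $\mu_i$ constant (so $\mathrm{Ric}_{F_i}=\mu_ig_{F_i}$). Let $\lambda\in C^\infty(B)$, let $\tau$ be the scalar curvature of $M$, and put $$A_i:=b_i^2\left(\sum_{k=1}^m s_k\,g_B\Big(\frac{\mathrm{grad}_Bb_i}{b_i},\frac{\mathrm{grad}_Bb_k}{b_k}\Big)+\frac{\Delta_Bb_i}{b_i}-\frac{\|\mathrm{grad}_Bb_i\|_B^2}{b_i^2}+\lambda\right)-\mu_i .$$ Consider the condition $$\mathrm{Ric}_B=\lambda g_B+\sum_{i=1}^m\frac{s_i}{b_i}H_B^{b_i}.\qquad( * )$$ Then: (1) $( * )$ implies $\displaystyle\sum_{i=1}^m s_i\frac{1}{b_i^2}A_i=\lambda\Big(n+\sum_{i=1}^m s_i\Big)-\tau$. (2) If in addition $\tau=\lambda(n+\sum_{i=1}^m s_i)$, then $( * )$ implies $\displaystyle\sum_{i=1}^m s_i\frac{1}{b_i^2}A_i=0$. (3) If $M$ is Einstein with $\mathrm{Ric}=\lambda g$, then $\displaystyle\sum_{i=1}^m s_i\frac{1}{b_i^2}A_i=0$.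
   Context: All manifolds are semi-Riemannian. The multiply warped product $B\times_{b_1}F_1\times\cdots\times_{b_m}F_m$, with $b_i$ smooth positive functions on $B$, is the product manifold $B\times F_1\times\cdots\times F_m$ with metric $g=g_B\oplus b_1^2g_{F_1}\oplus\cdots\oplus b_m^2g_{F_m}$, and $\mathrm{Ric}$ is its Ricci tensor (sign such that round spheres have positive Ricci curvature); functions on $B$ are lifted to the product. For $f\in C^\infty(B)$, $\mathrm{grad}_Bf$ is the $g_B$-gradient, $H_B^f(X,Y)=XYf-(\nabla^B_XY)f$ the Hessian, $\Delta_Bf$ the $g_B$-trace of $H_B^f$, and $\|\mathrm{grad}_Bf\|_B^2=g_B(\mathrm{grad}_Bf,\mathrm{grad}_Bf)$. *)

(* Defs.v *)
From HB Require Import structures.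
From mathcomp Require Import all_boot all_order all_algebra.
From mathcomp Require Import all_classical all_reals all_analysis.
Import Order.TTheory GRing.Theory Num.Theory.
Import numFieldNormedType.Exports.

Set Implicit Arguments.
Unset Strict Implicit.
Unset Printing Implicit Defensive.

Local Open Scope classical_set_scope.
Local Open Scope ring_scope.

(* A point of R^n is a row vector. *)

Definition partial (R : realType) (n : nat) (i : 'I_n) (f : 'rV[R]_n -> R)
    (x : 'rV[R]_n) : R :=
  'D_(delta_mx ord0 i) f x.

Fixpoint Ck (R : realType) (n k : nat) (U : set 'rV[R]_n) (f : 'rV[R]_n -> R)
    : Prop :=
  (forall x, U x -> {for x, continuous f}) /\
  if k is k'.+1 then
    forall i : 'I_n,
      (forall x, U x -> derivable f x (delta_mx ord0 i)) /\
      Ck k' U (partial i f)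
  else True.

(* U is meant to be open *)
Definition smooth_on (R : realType) (n : nat) (U : set 'rV[R]_n)
    (f : 'rV[R]_n -> R) : Prop :=
  forall k, Ck k U f.

(* Semi-Riemannian geometry in one chart. G x is the Gram matrix of the       *)
(* coordinate fields d_0, ..., d_(n-1) at the point of coordinates x, and     *)
(* tangent vectors are the row vectors of their components in that frame.     *)

Section LocalGeometry.
Context {R : realType} {n : nat} (G : 'rV[R]_n -> 'M[R]_n).

(* Levi-Civita connection: nabla_(d_i) d_j = \sum_k (christoffel k i j) d_k   *)
Definition christoffel (k i j : 'I_n) (x : 'rV[R]_n) : R :=
  2^-1 * \sum_l invmx (G x) k l *
    (partial i (fun y => G y j l) x + partial j (fun y => G y i l) x
     - partial l (fun y => G y i j) x).

(* R(d_i, d_j) d_k = \sum_l (riemann l k i j) d_l, where                      *)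
(* R(X, Y) Z = nabla_X nabla_Y Z - nabla_Y nabla_X Z - nabla_[X, Y] Z         *)
Definition riemann (l k i j : 'I_n) (x : 'rV[R]_n) : R :=
  partial i (christoffel l j k) x - partial j (christoffel l i k) x
  + \sum_h (christoffel l i h x * christoffel h j k x
            - christoffel l j h x * christoffel h i k x).

(* Ric(Y, Z) is the trace of X |-> R(X, Y) Z, positive on round spheres       *)
Definition ricci (x : 'rV[R]_n) : 'M[R]_n :=
  \matrix_(j, k) \sum_i riemann i k i j x.

(* H(d_i, d_j) = d_i d_j f - (nabla_(d_i) d_j) f                              *)
Definition hessian (f : 'rV[R]_n -> R) (x : 'rV[R]_n) : 'M[R]_n :=
  \matrix_(i, j) (partial i (partial j f) x
                  - \sum_k christoffel k i j x * partial k f x).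

Definition inner (x u v : 'rV[R]_n) : R := (u *m G x *m v^T) ord0 ord0.

(* the vector u such that inner x u v = df(v) for all v                       *)
Definition gradient (f : 'rV[R]_n -> R) (x : 'rV[R]_n) : 'rV[R]_n :=
  (\row_j partial j f x) *m invmx (G x).

Definition metric_trace (x : 'rV[R]_n) (T : 'M[R]_n) : R :=
  \tr (invmx (G x) *m T).

End LocalGeometry.

(* The index of a symmetric bilinear form g on R^n: the largest dimension of  *)
(* a subspace on which g is negative definite. Such a subspace is presented   *)
(* by a k x n matrix; its rows are then linearly independent.                 *)

Definition negative_on (R : realType) (n k : nat) (g : 'M[R]_n)
    (V : 'M[R]_(k, n)) : Prop :=
  forall v : 'rV[R]_k, v != 0 -> (v *m V *m g *m (v *m V)^T) ord0 ord0 < 0.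

Definition has_index (R : realType) (n : nat) (g : 'M[R]_n) (nu : nat) : Prop :=
  (exists V : 'M[R]_(nu, n), negative_on g V) /\
  (forall (k : nat) (V : 'M[R]_(k, n)), negative_on g V -> (k <= nu)%N).

(* A topological space with an indexed atlas and, for each chart c, the       *)
(* matrix-valued function of the coordinates which represents the metric.     *)
(* param c is the inverse of coord c; coord c, param c and metric c are only  *)
(* relevant on dom c and chart_image c. The axioms are in semi_riemannian     *)
(* below. chart_at p is a distinguished chart around p, used to evaluate      *)
(* quantities at p that do not depend on the chart.                           *)

Record charted_metric (R : realType) (n : nat) := ChartedMetric {
  carrier :> topologicalType;
  chart : Type;
  dom : chart -> set carrier;
  coord : chart -> carrier -> 'rV[R]_n;
  param : chart -> 'rV[R]_n -> carrier;
  chart_at : carrier -> chart;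
  metric : chart -> 'rV[R]_n -> 'M[R]_n
}.

Section Manifold.
Context {R : realType} {n : nat} (M : charted_metric R n).
Implicit Types (c d : chart M) (p : M).

Definition chart_image c : set 'rV[R]_n := coord c @` dom c.

Definition transition c d (x : 'rV[R]_n) : 'rV[R]_n := coord d (param c x).

Record smooth_manifold : Prop := SmoothManifold {
  manifold_hausdorff : hausdorff_space M;
  manifold_second_countable : @second_countable M;
  mem_chart_at : forall p, dom (chart_at p) p;
  open_dom : forall c, open (dom c);
  open_chart_image : forall c, open (chart_image c);
  coordK : forall c p, dom c p -> param c (coord c p) = p;
  continuous_coord : forall c p, dom c p -> {for p, continuous (coord c)};
  continuous_param : forall c x,
    chart_image c x -> {for x, continuous (param c)};
  smooth_transition : forall c d (j : 'I_n),
    smooth_on (coord c @` (dom c `&` dom d))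
              (fun x => transition c d x ord0 j)
}.

Record semi_riemannian : Prop := SemiRiemannian {
  semi_riemannian_manifold : smooth_manifold;
  smooth_metric : forall c (i j : 'I_n),
    smooth_on (chart_image c) (fun x => metric c x i j);
  metric_sym : forall c x, chart_image c x -> (metric c x)^T = metric c x;
  metric_unit : forall c x, chart_image c x -> metric c x \in unitmx;
  metric_transition : forall c d x, (coord c @` (dom c `&` dom d)) x ->
    let J := jacobian (transition c d) x in
    metric c x = J *m metric d (transition c d x) *m J^T;
  metric_index : exists nu : nat,
    forall c x, chart_image c x -> has_index (metric c x) nu
}.

Definition smooth_function (f : M -> R) : Prop :=
  forall c, smooth_on (chart_image c) (f \o param c).

Definition metric_at c p : 'M[R]_n := metric c (coord c p).

Definition ricci_at c p : 'M[R]_n := ricci (metric c) (coord c p).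

Definition hessian_at c (f : M -> R) p : 'M[R]_n :=
  hessian (metric c) (f \o param c) (coord c p).

Definition gradient_at c (f : M -> R) p : 'rV[R]_n :=
  gradient (metric c) (f \o param c) (coord c p).

Definition scalar_curvature p : R :=
  let c := chart_at p in
  metric_trace (metric c) (coord c p) (ricci_at c p).

Definition laplacian (f : M -> R) p : R :=
  let c := chart_at p in
  metric_trace (metric c) (coord c p) (hessian_at c f p).

(* g((grad f)/f, (grad h)/h) *)
Definition log_grad_inner (f h : M -> R) p : R :=
  let c := chart_at p in
  inner (metric c) (coord c p)
    ((f p)^-1 *: gradient_at c f p) ((h p)^-1 *: gradient_at c h p).

Definition grad_sqnorm (f : M -> R) p : R :=
  let c := chart_at p in
  inner (metric c) (coord c p) (gradient_at c f p) (gradient_at c f p).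

(* the identity of tensors is required in every chart *)
Definition ricci_proportional (f : M -> R) : Prop :=
  forall c p, dom c p -> ricci_at c p = f p *: metric_at c p.

Definition einstein : Prop := exists k : R, ricci_proportional (fun=> k).

End Manifold.

(* B x_(b_0) F_0 x ... x_(b_(m-1)) F_(m-1), with the product charts. The      *)
(* coordinates of B come first, followed by those of F_0, ..., F_(m-1).       *)

Section MultiplyWarpedProduct.
Context {R : realType} {m n : nat}.
Variables (s : 'I_m -> nat) (B : charted_metric R n)
          (F : forall i, charted_metric R (s i)).
Variable b : 'I_m -> B -> R.

Definition warped_carrier : topologicalType :=
  (B * prod_topology (fun i => carrier (F i)))%type.

Definition warped_chart : Type := (chart B * (forall i, chart (F i)))%type.

Definition warped_dom (c : warped_chart) : set warped_carrier :=
  [set p | dom c.1 p.1 /\ forall i, dom (c.2 i) (p.2 i)].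

Definition warped_coord (c : warped_chart) (p : warped_carrier)
    : 'rV[R]_(n + \sum_i s i) :=
  row_mx (coord c.1 p.1) (\mxrow_i coord (c.2 i) (p.2 i)).

Definition warped_param (c : warped_chart) (x : 'rV[R]_(n + \sum_i s i))
    : warped_carrier :=
  (param c.1 (lsubmx x), fun i => param (c.2 i) (submxrow (rsubmx x) i)).

Definition warped_chart_at (p : warped_carrier) : warped_chart :=
  (chart_at p.1, fun i => chart_at (p.2 i)).

Definition warped_metric (c : warped_chart) (x : 'rV[R]_(n + \sum_i s i))
    : 'M[R]_(n + \sum_i s i) :=
  block_mx
    (metric c.1 (lsubmx x)) 0
    0 (\mxdiag_i (b i (param c.1 (lsubmx x)) ^+ 2
                  *: metric (c.2 i) (submxrow (rsubmx x) i))).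

Definition warped_product : charted_metric R (n + \sum_i s i) :=
  {| carrier := warped_carrier;
     chart := warped_chart;
     dom := warped_dom;
     coord := warped_coord;
     param := warped_param;
     chart_at := warped_chart_at;
     metric := warped_metric |}.

Definition base_ricci_condition (lambda : B -> R) : Prop :=
  forall (c : chart B) (p : B), dom c p ->
    ricci_at c p =
      lambda p *: metric_at c p
      + \sum_i ((s i)%:R / b i p) *: hessian_at c (b i) p.

Definition fiber_defect (lambda : B -> R) (mu : 'I_m -> R) (i : 'I_m) (p : B)
    : R :=
  b i p ^+ 2 *
    (\sum_k (s k)%:R * log_grad_inner (b i) (b k) p
     + laplacian (b i) p / b i p
     - grad_sqnorm (b i) p / b i p ^+ 2
     + lambda p)
  - mu i.

End MultiplyWarpedProduct.

(* Main.v *)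
Require Import Defs.
From HB Require Import structures.
From mathcomp Require Import all_boot all_order all_algebra.
From mathcomp Require Import all_classical all_reals all_analysis.
From mathcomp Require Import ring.
Import Order.TTheory GRing.Theory Num.Theory.
Import numFieldNormedType.Exports.

Local Open Scope classical_set_scope.
Local Open Scope ring_scope.

(** Everything takes place in one product chart around a point, where the metric is
the block matrix diag(g_B, phi_1^2 g_1, ..., phi_m^2 g_m), with phi_i = b_i in the chart
of the base. Its Christoffel symbols split into those of the factors together with
two mixed families, for a fiber of index i,
  Gamma^A_(bB) = delta_AB (d_b phi_i) / phi_i,
  Gamma^c_(AB) = - phi_i (grad phi_i)^c (g_i)_AB.
Inserting them into the definition of the Ricci tensor gives, on the base block,
  Ric_B - sum_i (s_i / phi_i) Hess phi_i       ([ricci_warp_base])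
and, on the block of fiber i,
  Ric_i - K_i g_i                              ([ricci_warp_fiber])
  K_i = phi_i Lap phi_i + phi_i sum_k (s_k / phi_k) <grad phi_i, grad phi_k>
        - |grad phi_i|^2.
The only identity that is more than bookkeeping is that the term
d_c (grad phi_i)^c + Gamma^c_cd (grad phi_i)^d, which the fiber block produces, is the
Laplacian: this is [divergence_gradient], and it rests on the metric being parallel.

The quantity A_i of the theorem equals K_i + b_i^2 lambda - mu_i. Condition ( * ) says
that the base block of the Ricci tensor of the product is lambda g_B, and so does the
base block of the Einstein equation. Either way the trace over the base is lambda n,
and since the trace of Ric_i is s_i mu_i, tracing over the fibers
([metric_trace_warp_ricci]) yields
  tau = lambda n + sum_i s_i (mu_i - K_i) / b_i^2,
that is lambda (n + sum_i s_i) - tau = sum_i s_i A_i / b_i^2. When tau equals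
lambda (n + sum_i s_i), by hypothesis or as the trace of the Einstein equation, the sum
vanishes. *)

(** * Directional derivatives of algebraic expressions *)

Section Derivability.
Context {R : realType} {V : normedModType R}.
Implicit Types (f g : V -> R) (x v : V).

Lemma derivable_fun_sum (I : Type) (r : seq I) (P : pred I) (f : I -> V -> R) x v :
  (forall i, P i -> derivable (f i) x v) ->
  derivable (fun y => \sum_(i <- r | P i) f i y) x v.
Proof.
move=> df; elim: r => [|i r IH].
  by under eq_fun do rewrite big_nil; exact: derivable_cst.
under eq_fun do rewrite big_cons.
by case: (boolP (P i)) => Pi //; apply: derivableD => //; exact: df.
Qed.

Lemma derivable_fun_prod (I : Type) (r : seq I) (P : pred I) (f : I -> V -> R) x v :
  (forall i, P i -> derivable (f i) x v) ->
  derivable (fun y => \prod_(i <- r | P i) f i y) x v.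
Proof.
move=> df; elim: r => [|i r IH].
  by under eq_fun do rewrite big_nil; exact: derivable_cst.
under eq_fun do rewrite big_cons.
by case: (boolP (P i)) => Pi //; apply: derivableM => //; exact: df.
Qed.

Lemma derive_fun_sum (I : Type) (r : seq I) (P : pred I) (f : I -> V -> R) x v :
  (forall i, P i -> derivable (f i) x v) ->
  'D_v (fun y => \sum_(i <- r | P i) f i y) x = \sum_(i <- r | P i) 'D_v (f i) x.
Proof.
move=> df; elim: r => [|i r IH].
  by under eq_fun do rewrite big_nil; rewrite big_nil derive_cst.
rewrite big_cons; under eq_fun do rewrite big_cons.
case: (boolP (P i)) => Pi //; rewrite -IH.
by apply: deriveD; [exact: df|exact: derivable_fun_sum].
Qed.

Lemma derivable_det n (A : V -> 'M[R]_n) x v :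
  (forall i j, derivable (fun y => A y i j) x v) ->
  derivable (fun y => \det (A y)) x v.
Proof.
move=> dA; apply: derivable_fun_sum => s _.
apply: (derivableM (f := fun=> _)); first exact: derivable_cst.
by apply: derivable_fun_prod => i _.
Qed.

Lemma derivable_cofactor n (A : V -> 'M[R]_n) x v :
  (forall i j, derivable (fun y => A y i j) x v) ->
  forall i j, derivable (fun y => cofactor (A y) i j) x v.
Proof.
move=> dA i j; apply: (derivableM (f := fun=> _)); first exact: derivable_cst.
apply: derivable_det => k l; under eq_fun do rewrite !mxE.
exact: dA.
Qed.

(** By Cramer's rule the entries of an inverse are quotients of polynomials in
the entries of the matrix. *)
Lemma derivable_invmx n (A : V -> 'M[R]_n) x v :
  (\forall y \near x, A y \in unitmx) ->
  (forall i j, derivable (fun y => A y i j) x v) ->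
  forall i j, derivable (fun y => invmx (A y) i j) x v.
Proof.
move=> uA dA i j.
apply: (@near_eq_derivable _ _ _ (fun y => (\det (A y))^-1 * cofactor (A y) j i)).
  near=> y; rewrite /invmx.
  have -> : A y \in unitmx by near: y.
  by rewrite !mxE.
apply: (derivableM (f := fun y => (\det (A y))^-1)); last exact: derivable_cofactor.
apply: derivableV; last exact: derivable_det.
by have := nbhs_singleton uA; rewrite unitmxE unitfE.
Unshelve. all: by end_near. Qed.

(** Differentiate [A^-1 *m A = 1]. *)
Lemma derive_invmx n (A : V -> 'M[R]_n) x v :
  (\forall y \near x, A y \in unitmx) ->
  (forall i j, derivable (fun y => A y i j) x v) ->
  \matrix_(i, j) 'D_v (fun y => invmx (A y) i j) x =
  - (invmx (A x) *m (\matrix_(i, j) 'D_v (fun y => A y i j) x) *m invmx (A x)).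
Proof.
move=> uA dA; have Ax := nbhs_singleton uA.
have dI := derivable_invmx _ _ _ _ uA dA.
set DI := \matrix_(i, j) _; set DA := \matrix_(i, j) _.
suff E : DI *m A x + invmx (A x) *m DA = 0.
  by rewrite -[DI](mulmxK Ax); move/eqP: E; rewrite addr_eq0 => /eqP ->; rewrite mulNmx.
apply/matrixP => i j; rewrite !mxE -big_split /=.
transitivity ('D_v (fun y => \sum_k invmx (A y) i k * A y k j) x).
  rewrite derive_fun_sum; last first.
    by move=> k _; apply: derivableM; [exact: dI|exact: dA].
  apply: eq_bigr => k _.
  rewrite !mxE [RHS]deriveM; [|exact: dI|exact: dA].
  by rewrite addrC; congr (_ + _); exact: mulrC.
rewrite (@near_eq_derive _ _ _ _ (fun=> (1%:M : 'M[R]_n) i j)) ?derive_cst //.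
near=> y; have uy : A y \in unitmx by near: y.
by rewrite -(mulVmx uy) mxE.
Unshelve. all: by end_near. Qed.

End Derivability.

Section PartialCalculus.
Context {R : realType} {n : nat}.
Implicit Types (f g : 'rV[R]_n -> R) (x : 'rV[R]_n) (i : 'I_n).

Lemma partial_near f g x i :
  (\forall y \near x, f y = g y) -> partial i f x = partial i g x.
Proof. exact: near_eq_derive. Qed.

Lemma eq_partial f g x i : f =1 g -> partial i f x = partial i g x.
Proof. by move=> /funext ->. Qed.

Lemma partial_cst (c : R) x i : partial i (fun=> c) x = 0.
Proof. exact: derive_cst. Qed.

Lemma partialM f g x i :
  derivable f x (delta_mx ord0 i) -> derivable g x (delta_mx ord0 i) ->
  partial i (fun y => f y * g y) x = partial i f x * g x + f x * partial i g x.
Proof. by move=> df dg; rewrite /partial [LHS]deriveM // addrC mulrC. Qed.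

Lemma partialN f x i : derivable f x (delta_mx ord0 i) ->
  partial i (fun y => - f y) x = - partial i f x.
Proof. exact: deriveN. Qed.

Lemma partialV f x i : f x != 0 -> derivable f x (delta_mx ord0 i) ->
  partial i (fun y => (f y)^-1) x = - (f x ^+ 2)^-1 * partial i f x.
Proof. exact: deriveV. Qed.

End PartialCalculus.

(** * The Levi-Civita connection of a metric in coordinates *)

Lemma christoffelC {R : realType} {n : nat} (g : 'rV[R]_n -> 'M[R]_n) x k i j :
  (\forall y \near x, (g y)^T = g y) ->
  christoffel g k i j x = christoffel g k j i x.
Proof.
move=> gC; rewrite /christoffel; congr (_ * _); apply: eq_bigr => l _.
congr (_ * (_ - _)); first by rewrite addrC.
by apply: partial_near; near=> y; rewrite -[in LHS](near gC y) // mxE.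
Unshelve. all: by end_near. Qed.

(** Only first partial derivatives are required: second derivatives of a metric enter
below solely through the curvature tensors of the factors, which are never expanded. *)
Record local_metric {R : realType} {n : nat} (U : set 'rV[R]_n)
    (g : 'rV[R]_n -> 'M[R]_n) : Prop := LocalMetric {
  local_sym : forall y, U y -> (g y)^T = g y;
  local_unit : forall y, U y -> g y \in unitmx;
  local_derivable : forall y, U y ->
    forall i j k, derivable (fun z => g z i j) y (delta_mx ord0 k)
}.

Section LocalMetric.
Context {R : realType} {n : nat} {U : set 'rV[R]_n} {g : 'rV[R]_n -> 'M[R]_n}.
Context (openU : open U) (gP : local_metric U g).
Implicit Types (x : 'rV[R]_n) (i j k : 'I_n).

Lemma local_near x : U x -> \forall y \near x, U y.
Proof. by move=> Ux; exact: open_nbhs_nbhs. Qed.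

Lemma local_metricC x i j : U x -> g x i j = g x j i.
Proof. by move=> Ux; rewrite -[in LHS](local_sym _ _ gP _ Ux) mxE. Qed.

Lemma invmx_metricC x i j : U x -> invmx (g x) i j = invmx (g x) j i.
Proof.
by move=> Ux; rewrite -[in LHS](local_sym _ _ gP _ Ux) -trmx_inv mxE.
Qed.

Lemma partial_metricC x i j k : U x ->
  partial k (fun y => g y i j) x = partial k (fun y => g y j i) x.
Proof.
move=> Ux; apply: partial_near; near=> y; apply: local_metricC.
by near: y; exact: local_near.
Unshelve. all: by end_near. Qed.

Lemma derivable_inverse_metric x i j k : U x ->
  derivable (fun y => invmx (g y) i j) x (delta_mx ord0 k).
Proof.
move=> Ux; apply: derivable_invmx => [|a b]; last exact: (local_derivable _ _ gP).
by near=> y; apply: (local_unit _ _ gP); near: y; exact: local_near.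
Unshelve. all: by end_near. Qed.

Lemma partial_inverse_metric x i j k : U x ->
  partial k (fun y => invmx (g y) i j) x =
  - \sum_l \sum_c invmx (g x) i l * partial k (fun y => g y l c) x * invmx (g x) c j.
Proof.
move=> Ux.
have /matrixP/(_ i j) : \matrix_(i, j) 'D_(delta_mx ord0 k) (fun y => invmx (g y) i j) x =
    - (invmx (g x) *m (\matrix_(i, j) 'D_(delta_mx ord0 k) (fun y => g y i j) x)
       *m invmx (g x)).
  apply: derive_invmx => [|a b]; last exact: (local_derivable _ _ gP).
  by near=> y; apply: (local_unit _ _ gP); near: y; exact: local_near.
rewrite !mxE /partial => ->; congr (- _); rewrite exchange_big /=; apply: eq_bigr => c _.
by rewrite !mxE mulr_suml; apply: eq_bigr => l _; rewrite mxE.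
Unshelve. all: by end_near. Qed.

(** This is the contraction over [c] of the covariant derivative of the inverse metric, and
the inverse metric is parallel. In terms of the sums [S1] and [S2] below, which involve
the derivatives of the metric only, the three summands are [- S1], [S2 / 2] and
[S1 - S2 / 2]. *)
Lemma inverse_metric_parallel x j : U x ->
  \sum_c partial c (fun y => invmx (g y) j c) x
  + \sum_c \sum_d christoffel g c c d x * invmx (g x) j d
  + \sum_c \sum_d invmx (g x) c d * christoffel g j d c x = 0.
Proof.
move=> Ux; set h := invmx (g x).
have hC a b : h a b = h b a by exact: invmx_metricC.
pose D k a b := partial k (fun y => g y a b) x.
have DC k a b : D k a b = D k b a by exact: partial_metricC.
pose S1 := \sum_l \sum_c \sum_d h j l * h c d * D d c l.
pose S2 := \sum_l \sum_c \sum_d h j l * h c d * D l c d.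
have E1 : \sum_c partial c (fun y => invmx (g y) j c) x = - S1.
  under eq_bigr do rewrite partial_inverse_metric //.
  rewrite sumrN exchange_big /=; congr (- _); apply: eq_bigr => l _.
  rewrite exchange_big; apply: eq_bigr => c _; apply: eq_bigr => d _.
  by rewrite -/(D d l c) DC -!/h; ring.
(* the inverse metric is symmetric, so only the symmetric part of [F] contributes *)
have swap (F : 'I_n -> 'I_n -> R) :
    \sum_c \sum_d h c d * F c d = \sum_c \sum_d h c d * F d c.
  rewrite exchange_big; apply: eq_bigr => c _; apply: eq_bigr => d _.
  by rewrite hC.
have E2 : \sum_c \sum_d christoffel g c c d x * h j d = 2^-1 * S2.
  rewrite exchange_big mulr_sumr /=; apply: eq_bigr => l _.
  rewrite -mulr_suml /christoffel -mulr_sumr -mulrA; congr (_ * _).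
  transitivity ((\sum_c \sum_d h c d * D l c d) * h j l); last first.
    rewrite mulr_suml; apply: eq_bigr => c _; rewrite mulr_suml.
    by apply: eq_bigr => d _; ring.
  congr (_ * _); apply/eqP; rewrite -subr_eq0 -sumrB.
  under eq_bigr do rewrite -sumrB.
  rewrite (eq_bigr (fun c => \sum_d (h c d * D c l d - h c d * D d l c))).
    under eq_bigr do rewrite sumrB.
    by rewrite sumrB (swap (fun c d => D c l d)) subrr.
  move=> c _; apply: eq_bigr => d _.
  by rewrite -/(D c l d) -/(D l c d) -/(D d c l) (DC d c l) -/h; ring.
have E3 : \sum_c \sum_d h c d * christoffel g j d c x = S1 - 2^-1 * S2.
  have -> : \sum_c \sum_d h c d * christoffel g j d c x =
      \sum_l h j l * \sum_c \sum_d h c d * (2^-1 * (D d c l + D c d l - D l d c)).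
    under [RHS]eq_bigr => l _ do rewrite mulr_sumr.
    rewrite [RHS]exchange_big; apply: eq_bigr => c _.
    under [RHS]eq_bigr => l _ do rewrite mulr_sumr.
    rewrite [RHS]exchange_big; apply: eq_bigr => d _.
    rewrite /christoffel !mulr_sumr; apply: eq_bigr => l _.
    by rewrite -/(D d c l) -/(D c d l) -/(D l d c) -/h; ring.
  rewrite /S1 /S2 mulr_sumr -sumrB; apply: eq_bigr => l _.
  transitivity (h j l * (2^-1 * (\sum_c \sum_d h c d * D d c l)
      + 2^-1 * (\sum_c \sum_d h c d * D c d l)
      - 2^-1 * (\sum_c \sum_d h c d * D l c d))).
    congr (_ * _); rewrite !mulr_sumr -big_split -sumrB; apply: eq_bigr => c _ /=.
    rewrite !mulr_sumr -big_split -sumrB; apply: eq_bigr => d _ /=.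
    by rewrite (DC l d c); ring.
  rewrite (swap (fun c d => D c d l)).
  rewrite -mulrDl [2^-1 + _](_ : _ = 1); last by field.
  rewrite mul1r mulrBr mulrCA; congr (_ - _ * _); rewrite mulr_sumr.
    by apply: eq_bigr => c _; rewrite mulr_sumr; apply: eq_bigr => d _; ring.
  by apply: eq_bigr => c _; rewrite mulr_sumr; apply: eq_bigr => d _; ring.
by rewrite E1 E2 E3; ring.
Qed.

Lemma gradientE f x c : gradient g f x ord0 c = \sum_j partial j f x * invmx (g x) j c.
Proof. by rewrite mxE; apply: eq_bigr => j _; rewrite mxE. Qed.

Lemma inner_gradient f f' x : U x ->
  inner g x (gradient g f x) (gradient g f' x) =
  \sum_c gradient g f x ord0 c * partial c f' x.
Proof.
move=> Ux; rewrite /inner {2}/gradient trmx_mul mulmxA trmx_inv (local_sym _ _ gP _ Ux).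
by rewrite mulmxK ?(local_unit _ _ gP) // mxE; apply: eq_bigr => c _; rewrite !mxE.
Qed.

(** The difference of the two sides is the contraction of [inverse_metric_parallel] with
the differential of [f]: the second derivatives of [f] agree term by term. *)
Lemma divergence_gradient f x : U x ->
  (forall j k, derivable (partial j f) x (delta_mx ord0 k)) ->
  \sum_c partial c (fun y => gradient g f y ord0 c) x
  + \sum_c \sum_d christoffel g c c d x * gradient g f x ord0 d =
  metric_trace g x (hessian g f x).
Proof.
move=> Ux df; set h := invmx (g x).
have -> : \sum_c partial c (fun y => gradient g f y ord0 c) x =
    \sum_c \sum_j partial c (partial j f) x * h j c
    + \sum_j partial j f x * \sum_c partial c (fun y => invmx (g y) j c) x.
  under [X in _ + X]eq_bigr do rewrite mulr_sumr.
  rewrite [X in _ + X]exchange_big -big_split; apply: eq_bigr => c _ /=.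
  under eq_fun do rewrite gradientE.
  rewrite [LHS]derive_fun_sum => [|j _]; last first.
    by apply: derivableM; [exact: df|exact: derivable_inverse_metric].
  rewrite -big_split; apply: eq_bigr => j _ /=.
  by rewrite [LHS]partialM //; exact: derivable_inverse_metric.
have -> : \sum_c \sum_d christoffel g c c d x * gradient g f x ord0 d =
    \sum_j partial j f x * \sum_c \sum_d christoffel g c c d x * h j d.
  under [RHS]eq_bigr do rewrite mulr_sumr.
  rewrite [RHS]exchange_big; apply: eq_bigr => c _ /=.
  under [RHS]eq_bigr do rewrite mulr_sumr.
  rewrite [RHS]exchange_big; apply: eq_bigr => d _ /=.
  by rewrite gradientE mulr_sumr; apply: eq_bigr => j _; rewrite -/h; ring.
have -> : metric_trace g x (hessian g f x) =
    \sum_c \sum_j partial c (partial j f) x * h j c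
    - \sum_j partial j f x * \sum_c \sum_d h c d * christoffel g j d c x.
  under [X in _ - X]eq_bigr do rewrite mulr_sumr.
  rewrite [X in _ - X]exchange_big [X in X - _]exchange_big -sumrB.
  apply: eq_bigr => c _ /=; rewrite mxE.
  under [X in _ - X]eq_bigr do rewrite mulr_sumr.
  rewrite [X in _ - X]exchange_big -sumrB.
  apply: eq_bigr => d _ /=; rewrite mxE mulrBr -/h; congr (_ - _); first by rewrite mulrC.
  by rewrite mulr_sumr; apply: eq_bigr => j _; ring.
rewrite -addrA; congr (_ + _); apply/eqP.
rewrite -addr_eq0 -!big_split /=; apply/eqP/big1 => j _.
by rewrite -!mulrDr inverse_metric_parallel // mulr0.
Qed.

End LocalMetric.

(** * Coordinates on a product *)

Section ProductIndices.
Context {m n : nat} {s : 'I_m -> nat}.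

Definition base_index (a : 'I_n) : 'I_(n + \sum_i s i) := lshift _ a.

Definition fiber_index (i : 'I_m) (A : 'I_(s i)) : 'I_(n + \sum_i s i) :=
  rshift n (tagnat.Rank i A).

Lemma sum_product_index (V : zmodType) (f : 'I_(n + \sum_i s i) -> V) :
  \sum_k f k = \sum_a f (base_index a) + \sum_i \sum_A f (fiber_index i A).
Proof.
rewrite big_split_ord; congr (_ + _).
rewrite (reindex _ tagnat.rank_bij_on) /= sig_big_dep /=.
by apply: eq_bigr => -[i A] _.
Qed.

Lemma mxdiag_fiberE {R : pzRingType} (D : forall i, 'M[R]_(s i)) i A B :
  (\mxdiag_i D i) (tagnat.Rank i A) (tagnat.Rank i B) = D i A B.
Proof.
by have /matrixP/(_ A B) := submxblock_diag D i; rewrite mxE.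
Qed.

Lemma mxdiag_fiber0 {R : pzRingType} (D : forall i, 'M[R]_(s i)) i j
    (A : 'I_(s i)) (B : 'I_(s j)) :
  i != j -> (\mxdiag_i D i) (tagnat.Rank i A) (tagnat.Rank j B) = 0.
Proof.
move=> ij.
have := @mxblockK _ _ _ s s (fun j k => if j == k then conform_mx 0 (D j) else 0) i j.
by rewrite (negbTE ij) => /matrixP/(_ A B); rewrite mxE [RHS]mxE.
Qed.

End ProductIndices.

Section ProductCoordinates.
Context {R : realType} {m n : nat} {s : 'I_m -> nat}.
Notation N := (n + \sum_i s i)%N.
Implicit Types (x y : 'rV[R]_N) (i j : 'I_m).

Definition base_coord x : 'rV[R]_n := lsubmx x.
Definition fiber_coord i x : 'rV[R]_(s i) := submxrow (rsubmx x) i.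

Lemma continuous_base_coord : continuous base_coord.
Proof. exact: continuous_lsubmx. Qed.

Lemma continuous_fiber_coord i : continuous (fiber_coord i).
Proof.
move=> u A /nbhs_ballP[e /= e0 eA].
apply/nbhs_ballP; exists e => //= v [_ uv]; apply: eA; split => // k l.
by rewrite !mxE; exact: uv.
Qed.

Lemma base_coord_line (h : R) a x :
  base_coord (h *: delta_mx ord0 (base_index a) + x) =
  h *: delta_mx ord0 a + base_coord x.
Proof.
by apply/rowP => b; rewrite !mxE eq_lshift.
Qed.

Lemma fiber_coord_line0 (h : R) i a x :
  fiber_coord i (h *: delta_mx ord0 (base_index a) + x) = fiber_coord i x.
Proof.
by apply/rowP => b; rewrite !mxE eq_rlshift andbF mulr0 add0r.
Qed.

Lemma base_coord_line0 (h : R) i (A : 'I_(s i)) x :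
  base_coord (h *: delta_mx ord0 (fiber_index i A) + x) = base_coord x.
Proof.
by apply/rowP => b; rewrite !mxE eq_lrshift andbF mulr0 add0r.
Qed.

Lemma fiber_coord_line (h : R) i (A : 'I_(s i)) x :
  fiber_coord i (h *: delta_mx ord0 (fiber_index i A) + x) =
  h *: delta_mx ord0 A + fiber_coord i x.
Proof.
by apply/rowP => b; rewrite !mxE eq_rshift -[tagnat.Rank _ _ == _]val_eqE tagnat.eq_Rank eqxx.
Qed.

Lemma fiber_coord_line_neq (h : R) i j (A : 'I_(s i)) x : j != i ->
  fiber_coord j (h *: delta_mx ord0 (fiber_index i A) + x) = fiber_coord j x.
Proof.
move=> ji; apply/rowP => b.
by rewrite !mxE eq_rshift -[tagnat.Rank _ _ == _]val_eqE tagnat.eq_Rank (negbTE ji) andbF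
  mulr0 add0r.
Qed.

(** A directional derivative only sees the restriction to a line. *)
Lemma derive_line (V W : normedModType R) (f : V -> R) (g : W -> R)
    (x v : V) (y w : W) :
  (forall h, f (h *: v + x) = g (h *: w + y)) -> 'D_v f x = 'D_w g y.
Proof.
move=> fg; rewrite /derive; set F := fun h => _; set G := fun h => _.
suff -> : F = G by [].
apply/funext => h; rewrite /F /G /=.
by rewrite fg; have := fg 0; rewrite !scale0r !add0r => ->.
Qed.

(** The next lemmas differentiate functions pulled back from the factors: every entry of
the warped metric and every one of its Christoffel symbols is a function on the base
times a function on a single fiber. *)
Lemma partial_line0 (f : 'rV[R]_N -> R) x k :
  (forall h, f (h *: delta_mx ord0 k + x) = f x) -> partial k f x = 0.
Proof.
by move=> fx; rewrite /partial (derive_line _ _ f (fun=> f x) x _ x 0) ?derive_cst.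
Qed.

Lemma partial_base (u : 'rV[R]_n -> R) a x :
  partial (base_index a) (fun y => u (base_coord y)) x = partial a u (base_coord x).
Proof. by apply: derive_line => h; rewrite base_coord_line. Qed.

Lemma partial_base0 (u : 'rV[R]_n -> R) i A x :
  partial (fiber_index i A) (fun y => u (base_coord y)) x = 0.
Proof. by apply: partial_line0 => h; rewrite base_coord_line0. Qed.

Lemma partial_fiber i (v : 'rV[R]_(s i) -> R) A x :
  partial (fiber_index i A) (fun y => v (fiber_coord i y)) x =
  partial A v (fiber_coord i x).
Proof. by apply: derive_line => h; rewrite fiber_coord_line. Qed.

Lemma partial_base_fiber i (u : 'rV[R]_n -> R) (v : 'rV[R]_(s i) -> R) a x :
  derivable u (base_coord x) (delta_mx ord0 a) ->
  partial (base_index a) (fun y => u (base_coord y) * v (fiber_coord i y)) x =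
  partial a u (base_coord x) * v (fiber_coord i x).
Proof.
move=> du.
transitivity (partial a (fun z => u z * v (fiber_coord i x)) (base_coord x)).
  by apply: derive_line => h; rewrite base_coord_line fiber_coord_line0.
by rewrite partialM ?partial_cst ?mulr0 ?addr0 //; exact: derivable_cst.
Qed.

Lemma partial_fiber_fiber i (u : 'rV[R]_n -> R) (v : 'rV[R]_(s i) -> R) A x :
  derivable v (fiber_coord i x) (delta_mx ord0 A) ->
  partial (fiber_index i A) (fun y => u (base_coord y) * v (fiber_coord i y)) x =
  u (base_coord x) * partial A v (fiber_coord i x).
Proof.
move=> dv.
transitivity (partial A (fun q => u (base_coord x) * v q) (fiber_coord i x)).
  by apply: derive_line => h; rewrite base_coord_line0 fiber_coord_line.
by rewrite partialM ?partial_cst ?mul0r ?add0r //; exact: derivable_cst.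
Qed.

Lemma partial_fiber_neq i j (u : 'rV[R]_n -> R) (v : 'rV[R]_(s i) -> R)
    (A : 'I_(s j)) x : i != j ->
  partial (fiber_index j A) (fun y => u (base_coord y) * v (fiber_coord i y)) x = 0.
Proof.
move=> ij; apply: partial_line0 => h.
by rewrite base_coord_line0 fiber_coord_line_neq.
Qed.

End ProductCoordinates.

(** * The warped metric and its Christoffel symbols *)

Section WarpedMetric.
Context {R : realType} {m n : nat} {s : 'I_m -> nat}.
Notation N := (n + \sum_i s i)%N.
Context (gB : 'rV[R]_n -> 'M[R]_n) (gF : forall i, 'rV[R]_(s i) -> 'M[R]_(s i)).
Context (phi : 'I_m -> 'rV[R]_n -> R).
Context (UB : set 'rV[R]_n) (UF : forall i, set 'rV[R]_(s i)).
Context (openUB : open UB) (openUF : forall i, open (UF i)).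
Context (gBP : local_metric UB gB) (gFP : forall i, local_metric (UF i) (gF i)).
Context (phi_neq0 : forall i z, UB z -> phi i z != 0).
Context (dphi : forall i a z, UB z -> derivable (phi i) z (delta_mx ord0 a)).
Context (ddphi : forall i a b z, UB z ->
  derivable (partial a (phi i)) z (delta_mx ord0 b)).
Implicit Types (x y : 'rV[R]_N) (i j k : 'I_m) (a b c d : 'I_n).

Definition warp_metric x : 'M[R]_N :=
  block_mx (gB (lsubmx x)) 0
    0 (\mxdiag_i (phi i (lsubmx x) ^+ 2 *: gF i (submxrow (rsubmx x) i))).

Definition warp_domain : set 'rV[R]_N :=
  [set x | UB (base_coord x) /\ forall i, UF i (fiber_coord i x)].

Local Notation G := warp_metric.
Local Notation U := warp_domain.
Local Notation ib := (@base_index m n s).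
Local Notation fb := (@fiber_index m n s).

Lemma warp_domain_near x : U x -> \forall y \near x, U y.
Proof.
move=> [xB xF]; apply: filterI.
  by apply: continuous_base_coord; exact: open_nbhs_nbhs.
apply: (@filter_forall _ _ (fun i y => UF i (fiber_coord i y)) (nbhs x)) => i.
by apply: continuous_fiber_coord; exact: open_nbhs_nbhs.
Qed.

Lemma warp_metric_bb x a b : G x (ib a) (ib b) = gB (base_coord x) a b.
Proof. exact: block_mxEul. Qed.

Lemma warp_metric_bf x a i A : G x (ib a) (fb i A) = 0.
Proof. by rewrite /G block_mxEur mxE. Qed.

Lemma warp_metric_fb x a i A : G x (fb i A) (ib a) = 0.
Proof. by rewrite /G block_mxEdl mxE. Qed.

Lemma warp_metric_ff x i A B :
  G x (fb i A) (fb i B) = phi i (base_coord x) ^+ 2 * gF i (fiber_coord i x) A B.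
Proof. by rewrite /G block_mxEdr mxdiag_fiberE mxE. Qed.

Lemma warp_metric_ff0 x i j A B : i != j -> G x (fb i A) (fb j B) = 0.
Proof. by move=> ij; rewrite /G block_mxEdr mxdiag_fiber0. Qed.

Lemma warp_metric_sym x : U x -> (G x)^T = G x.
Proof.
move=> [xB xF]; rewrite /G tr_block_mx !trmx0 tr_mxdiag (local_sym _ _ gBP _ xB).
congr block_mx; apply: eq_mxdiag => i.
by rewrite linearZ /= (local_sym _ _ (gFP i) _ (xF i)).
Qed.

Lemma mul_mxdiag (D E : forall i, 'M[R]_(s i)) :
  (\mxdiag_i D i) *m (\mxdiag_i E i) = \mxdiag_i (D i *m E i).
Proof.
rewrite mul_mxdiag_mxblock; apply: eq_mxblock => i j.
by case: eqVneq => [<-|_]; rewrite ?conform_mx_id ?mulmx0.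
Qed.

Definition warp_inverse x : 'M[R]_N :=
  block_mx (invmx (gB (base_coord x))) 0 0
    (\mxdiag_i ((phi i (base_coord x) ^+ 2)^-1 *: invmx (gF i (fiber_coord i x)))).

Lemma mul_warp_inverse x : U x -> G x *m warp_inverse x = 1%:M.
Proof.
move=> [xB xF]; rewrite /G /warp_inverse mulmx_block !(mul0mx, mulmx0, addr0, add0r).
rewrite mulmxV ?(local_unit _ _ gBP) // mul_mxdiag scalar_mx_block; congr block_mx.
rewrite -mxdiagZ; apply: eq_mxdiag => i.
rewrite -scalemxAl -scalemxAr scalerA mulfV ?expf_neq0 ?phi_neq0 // scale1r.
by rewrite mulmxV ?(local_unit _ _ (gFP i)) //; exact: xF.
Qed.

Lemma warp_metric_unit x : U x -> G x \in unitmx.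
Proof. by move=> /mul_warp_inverse /mulmx1_unit []. Qed.

Lemma invmx_warp_metric x : U x -> invmx (G x) = warp_inverse x.
Proof.
move=> Ux; rewrite -[invmx _]mulmx1 -(mul_warp_inverse _ Ux) mulmxA.
by rewrite mulVmx ?mul1mx ?warp_metric_unit.
Qed.

Lemma invmx_warp_metric_b (T : 'I_N -> R) x c : U x ->
  \sum_k invmx (G x) (ib c) k * T k =
  \sum_d invmx (gB (base_coord x)) c d * T (ib d).
Proof.
move=> Ux; rewrite invmx_warp_metric // /warp_inverse sum_product_index addrC big1 ?add0r.
  by apply: eq_bigr => d _; rewrite block_mxEul.
by move=> i _; rewrite big1 // => A _; rewrite block_mxEur mxE mul0r.
Qed.

Lemma invmx_warp_metric_f (T : 'I_N -> R) x i C : U x ->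
  \sum_k invmx (G x) (fb i C) k * T k =
  (phi i (base_coord x) ^+ 2)^-1 *
  \sum_D invmx (gF i (fiber_coord i x)) C D * T (fb i D).
Proof.
move=> Ux; rewrite invmx_warp_metric // /warp_inverse sum_product_index big1 ?add0r;
  last first.
  by move=> d _; rewrite block_mxEdl mxE mul0r.
rewrite (bigD1 i) //= [X in _ + X]big1 ?addr0 => [|j ji].
  rewrite mulr_sumr; apply: eq_bigr => D _.
  by rewrite block_mxEdr mxdiag_fiberE mxE mulrA.
by rewrite big1 // => D _; rewrite block_mxEdr mxdiag_fiber0 ?mul0r // eq_sym.
Qed.

Lemma partial_bb_b x a b c :
  partial (ib c) (fun y => G y (ib a) (ib b)) x =
  partial c (fun z => gB z a b) (base_coord x).
Proof.
rewrite (eq_partial _ _ _ _ (fun y => warp_metric_bb y a b)).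
exact: (partial_base (fun z => gB z a b)).
Qed.

Lemma partial_bb_f x a b i C : partial (fb i C) (fun y => G y (ib a) (ib b)) x = 0.
Proof.
rewrite (eq_partial _ _ _ _ (fun y => warp_metric_bb y a b)).
exact: (partial_base0 (fun z => gB z a b)).
Qed.

Lemma partial_bf x a i A (k : 'I_N) : partial k (fun y => G y (ib a) (fb i A)) x = 0.
Proof. by rewrite (eq_partial _ _ _ _ (fun y => warp_metric_bf y a i A)) partial_cst. Qed.

Lemma partial_fb x a i A (k : 'I_N) : partial k (fun y => G y (fb i A) (ib a)) x = 0.
Proof. by rewrite (eq_partial _ _ _ _ (fun y => warp_metric_fb y a i A)) partial_cst. Qed.

Lemma partial_ff_b x i A B c : U x ->
  partial (ib c) (fun y => G y (fb i A) (fb i B)) x =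
  2 * phi i (base_coord x) * partial c (phi i) (base_coord x)
  * gF i (fiber_coord i x) A B.
Proof.
move=> [xB _]; rewrite (eq_partial _ _ _ _ (fun y => warp_metric_ff y i A B)).
rewrite (partial_base_fiber i (fun z => phi i z ^+ 2) (fun q => gF i q A B)).
  congr (_ * _); under eq_fun do rewrite expr2.
  by rewrite partialM; [ring|exact: dphi|exact: dphi].
by apply: (derivableM (f := phi i)); exact: dphi.
Qed.

Lemma partial_ff_f x i A B C : U x ->
  partial (fb i C) (fun y => G y (fb i A) (fb i B)) x =
  phi i (base_coord x) ^+ 2 * partial C (fun q => gF i q A B) (fiber_coord i x).
Proof.
move=> [_ xF]; rewrite (eq_partial _ _ _ _ (fun y => warp_metric_ff y i A B)).
rewrite (partial_fiber_fiber i (fun z => phi i z ^+ 2) (fun q => gF i q A B)) //.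
exact: (local_derivable _ _ (gFP i)).
Qed.

Lemma partial_ff0 x i j A B (k : 'I_N) : i != j ->
  partial k (fun y => G y (fb i A) (fb j B)) x = 0.
Proof.
by move=> ij; rewrite (eq_partial _ _ _ _ (fun y => warp_metric_ff0 y i j A B ij)) partial_cst.
Qed.

Lemma partial_fff0 x i j k A B C : (i != j) || (i != k) ->
  partial (fb k C) (fun y => G y (fb i A) (fb j B)) x = 0.
Proof.
case: (eqVneq i j) => [ij|ij _]; last exact: partial_ff0.
case: _ / ij B => B /= ik; rewrite (eq_partial _ _ _ _ (fun y => warp_metric_ff y i A B)).
exact: (partial_fiber_neq i k (fun z => phi i z ^+ 2) (fun q => gF i q A B)).
Qed.

Local Notation Gamma := (christoffel G).

(** As the inverse metric is block diagonal, the sum in a Christoffel symbol runs over the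
block of its upper index. In the names that follow, the letters after [christoffel] are
the types, base or fiber, of the upper index and of the two lower ones; a final 0 marks
a symbol that vanishes because its fiber indices belong to different fibers. *)
Lemma christoffel_b x c (i j : 'I_N) : U x ->
  Gamma (ib c) i j x = 2^-1 * \sum_d invmx (gB (base_coord x)) c d *
    (partial i (fun y => G y j (ib d)) x + partial j (fun y => G y i (ib d)) x
     - partial (ib d) (fun y => G y i j) x).
Proof.
move=> Ux; rewrite /christoffel; congr (_ * _).
exact: (invmx_warp_metric_b (fun l => partial i (fun y => G y j l) x
  + partial j (fun y => G y i l) x - partial l (fun y => G y i j) x)).
Qed.

Lemma christoffel_f x k C (i j : 'I_N) : U x ->
  Gamma (fb k C) i j x = 2^-1 * ((phi k (base_coord x) ^+ 2)^-1 *
    \sum_D invmx (gF k (fiber_coord k x)) C D *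
    (partial i (fun y => G y j (fb k D)) x + partial j (fun y => G y i (fb k D)) x
     - partial (fb k D) (fun y => G y i j) x)).
Proof.
move=> Ux; rewrite /christoffel; congr (_ * _).
exact: (invmx_warp_metric_f (fun l => partial i (fun y => G y j l) x
  + partial j (fun y => G y i l) x - partial l (fun y => G y i j) x)).
Qed.

Lemma warp_christoffelC x (k i j : 'I_N) : U x -> Gamma k i j x = Gamma k j i x.
Proof.
move=> Ux; apply: christoffelC; near=> y; apply: warp_metric_sym.
by near: y; exact: warp_domain_near.
Unshelve. all: by end_near. Qed.

Lemma christoffel_b_bb x c a b : U x ->
  Gamma (ib c) (ib a) (ib b) x = christoffel gB c a b (base_coord x).
Proof.
move=> Ux; rewrite christoffel_b // /christoffel; congr (_ * _).
by apply: eq_bigr => d _; rewrite !partial_bb_b.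
Qed.

Lemma christoffel_b_bf x c a i A : U x -> Gamma (ib c) (ib a) (fb i A) x = 0.
Proof.
move=> Ux; rewrite christoffel_b // big1 ?mulr0 // => d _.
by rewrite partial_fb partial_bb_f partial_bf addr0 subr0 mulr0.
Qed.

Lemma christoffel_b_fb x c a i A : U x -> Gamma (ib c) (fb i A) (ib a) x = 0.
Proof. by move=> Ux; rewrite warp_christoffelC // christoffel_b_bf. Qed.

Lemma christoffel_b_ff x c i A B : U x ->
  Gamma (ib c) (fb i A) (fb i B) x =
  - (phi i (base_coord x) * gradient gB (phi i) (base_coord x) ord0 c
     * gF i (fiber_coord i x) A B).
Proof.
move=> Ux; have [xB _] := Ux; rewrite christoffel_b // gradientE mulr_sumr.
rewrite mulr_sumr mulr_suml -sumrN; apply: eq_bigr => d _.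
rewrite !partial_fb partial_ff_b // (invmx_metricC gBP _ _ c) //.
by field.
Qed.

Lemma christoffel_b_ff0 x c i j A B : U x -> i != j ->
  Gamma (ib c) (fb i A) (fb j B) x = 0.
Proof.
move=> Ux ij; rewrite christoffel_b // big1 ?mulr0 // => d _.
by rewrite !partial_fb partial_ff0 // addr0 subr0 mulr0.
Qed.

Lemma christoffel_f_bb x k C a b : U x -> Gamma (fb k C) (ib a) (ib b) x = 0.
Proof.
move=> Ux; rewrite christoffel_f // big1 ?mulr0 // => D _.
by rewrite !partial_bf partial_bb_f addr0 subr0 mulr0.
Qed.

Lemma christoffel_f_bf x i A b B : U x ->
  Gamma (fb i A) (ib b) (fb i B) x =
  (A == B)%:R * (partial b (phi i) (base_coord x) / phi i (base_coord x)).
Proof.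
move=> Ux; have [xB xF] := Ux; rewrite christoffel_f //.
transitivity (\sum_D invmx (gF i (fiber_coord i x)) A D * gF i (fiber_coord i x) D B
   * (partial b (phi i) (base_coord x) / phi i (base_coord x))).
  rewrite !mulr_sumr; apply: eq_bigr => D _.
  rewrite partial_ff_b // !partial_bf (local_metricC (gFP i) _ B) //.
  by field; exact: phi_neq0.
rewrite -mulr_suml; congr (_ * _).
by have /matrixP/(_ A B) := mulVmx (local_unit _ _ (gFP i) _ (xF i)); rewrite !mxE.
Qed.

Lemma christoffel_f_bf0 x i j A b B : U x -> i != j ->
  Gamma (fb i A) (ib b) (fb j B) x = 0.
Proof.
move=> Ux ij; rewrite christoffel_f // big1 ?mulr0 // => D _.
by rewrite !partial_bf partial_ff0 1?eq_sym // addr0 subr0 mulr0.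
Qed.

Lemma christoffel_f_fb x i A b B : U x ->
  Gamma (fb i A) (fb i B) (ib b) x =
  (A == B)%:R * (partial b (phi i) (base_coord x) / phi i (base_coord x)).
Proof. by move=> Ux; rewrite warp_christoffelC // christoffel_f_bf. Qed.

Lemma christoffel_f_fb0 x i j A b B : U x -> i != j ->
  Gamma (fb i A) (fb j B) (ib b) x = 0.
Proof. by move=> Ux ij; rewrite warp_christoffelC // christoffel_f_bf0. Qed.

Lemma christoffel_f_ff x i C A B : U x ->
  Gamma (fb i C) (fb i A) (fb i B) x = christoffel (gF i) C A B (fiber_coord i x).
Proof.
move=> Ux; have [xB xF] := Ux; rewrite christoffel_f //; congr (_ * _).
rewrite mulr_sumr; apply: eq_bigr => D _; rewrite !partial_ff_f //.
by field; exact: phi_neq0.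
Qed.

Lemma christoffel_f_ff0 x k i j C A B : U x -> (k != i) || (k != j) ->
  Gamma (fb k C) (fb i A) (fb j B) x = 0.
Proof.
move=> Ux kij; rewrite christoffel_f // big1 ?mulr0 // => D _.
rewrite !partial_fff0 ?addr0 ?subr0 ?mulr0 //.
- by move: kij; case: (eqVneq i j) => [->|] //=; rewrite orbb eq_sym.
- by move: kij; case: (eqVneq i k) => [->|] //=; rewrite eqxx.
- move: kij; case: (eqVneq j k) => [->|] //=.
  by rewrite orbF eq_sym.
Qed.


(** * The Ricci tensor of the warped metric *)

Lemma indicator_refl (T : eqType) (t : T) : (t == t)%:R = 1 :> R.
Proof. by rewrite eqxx. Qed.

Lemma eq_partial_domain (f g : 'rV[R]_N -> R) x (k : 'I_N) : U x ->
  (forall y, U y -> f y = g y) -> partial k f x = partial k g x.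
Proof.
move=> Ux fg; apply: partial_near; near=> y; apply: fg.
by near: y; exact: warp_domain_near.
Unshelve. all: by end_near. Qed.

(** A summation index in the base reproduces the Ricci tensor of the base, since every
symbol with exactly one fiber index vanishes. Each of the [s i] indices of
fiber [i] contributes minus the Hessian of [phi i] divided by [phi i]: the derivative of
the logarithmic derivative of [phi i], its connection term, and a square
of logarithmic derivatives which cancels that of the quotient rule. *)
Lemma ricci_warp_base x a b : U x ->
  ricci G x (ib a) (ib b) = ricci gB (base_coord x) a b
  - \sum_i (s i)%:R / phi i (base_coord x) * hessian gB (phi i) (base_coord x) a b.
Proof.
move=> Ux; have [xB xF] := Ux; set z := base_coord x.
rewrite !mxE sum_product_index; congr (_ + _).
  apply: eq_bigr => c _; rewrite /riemann sum_product_index.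
  rewrite [X in _ + (_ + X)]big1 ?addr0 => [|i _]; last first.
    rewrite big1 // => A _.
    by rewrite !christoffel_f_bb // !mulr0 subrr.
  rewrite (eq_partial_domain _ _ _ _ Ux (fun y => christoffel_b_bb y c a b)).
  rewrite (eq_partial_domain _ _ _ _ Ux (fun y => christoffel_b_bb y c c b)).
  rewrite (partial_base (christoffel gB c a b)) (partial_base (christoffel gB c c b)).
  by congr (_ + _); apply: eq_bigr => d _; rewrite !christoffel_b_bb.
rewrite -sumrN; apply: eq_bigr => i _.
rewrite (eq_bigr (fun=> - (hessian gB (phi i) z a b / phi i z))).
  by rewrite sumr_const card_ord -[in LHS]mulr_natl mulrN mulrAC mulrA.
move=> C _; rewrite /riemann.
rewrite (eq_partial_domain _ _ _ _ Ux (fun y => christoffel_f_bb y i C a b)) partial_cst.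
rewrite (eq_partial_domain _ _ _ _ Ux (fun y => christoffel_f_fb y i C b C)).
rewrite (partial_base (fun z => (C == C)%:R * (partial b (phi i) z / phi i z))).
have -> : partial a (fun z => (C == C)%:R * (partial b (phi i) z / phi i z)) z =
    partial a (partial b (phi i)) z / phi i z
    - partial a (phi i) z * partial b (phi i) z / phi i z ^+ 2.
  transitivity (partial a (fun w => partial b (phi i) w * (phi i w)^-1) z).
    by apply: eq_partial => y; rewrite indicator_refl mul1r.
  rewrite partialM; [|exact: ddphi|by apply: derivableV; [exact: phi_neq0|exact: dphi]].
  rewrite partialV; [|exact: phi_neq0|exact: dphi].
  by field; exact: phi_neq0.
rewrite sum_product_index.
have -> : \sum_d (Gamma (fb i C) (fb i C) (ib d) x * Gamma (ib d) (ib a) (ib b) x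
    - Gamma (fb i C) (ib a) (ib d) x * Gamma (ib d) (fb i C) (ib b) x) =
    (\sum_d christoffel gB d a b z * partial d (phi i) z) / phi i z.
  rewrite mulr_suml; apply: eq_bigr => d _.
  rewrite christoffel_f_fb // indicator_refl christoffel_b_bb // christoffel_f_bb // -/z.
  by ring.
rewrite (bigD1 i) //= [X in _ + (_ + (_ + X))]big1 ?addr0 => [|j ji]; last first.
  rewrite big1 // => D _.
  by rewrite christoffel_f_bb // christoffel_f_bf0 1?eq_sym // mulr0 mul0r subrr.
rewrite (bigD1 C) //= [X in _ + (_ + (_ + X))]big1 ?addr0 => [|D DC]; last first.
  by rewrite christoffel_f_bb // christoffel_f_bf // eq_sym (negbTE DC) mulr0 !mul0r subrr.
rewrite christoffel_f_bb // christoffel_f_bf // christoffel_f_fb // indicator_refl -/z mxE.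
by field; exact: phi_neq0.
Qed.

(** The multiple of g_i that warping subtracts from the Ricci tensor of fiber i. The sum
includes k = i; with the last term this leaves the familiar coefficient s_i - 1
of |grad phi_i|^2. *)
Definition fiber_ricci_shift i (z : 'rV[R]_n) : R :=
  phi i z * metric_trace gB z (hessian gB (phi i) z)
  + phi i z * (\sum_k (s k)%:R / phi k z *
      \sum_c gradient gB (phi i) z ord0 c * partial c (phi k) z)
  - \sum_c gradient gB (phi i) z ord0 c * partial c (phi i) z.

Lemma derivable_gradient i a c (z : 'rV[R]_n) : UB z ->
  derivable (fun w => gradient gB (phi i) w ord0 c) z (delta_mx ord0 a).
Proof.
move=> zB; under eq_fun do rewrite gradientE.
apply: derivable_fun_sum => d _; apply: derivableM; first exact: ddphi.
exact: (derivable_inverse_metric openUB gBP).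
Qed.

(** The part of the Ricci tensor of a fiber obtained by tracing over the base. Up to the factor
g_i it is minus the covariant divergence of phi_i grad phi_i plus |grad phi_i|^2; the
product rule turns this into minus phi_i times the Laplacian. *)
Lemma ricci_warp_fiber_base x i A B : U x ->
  \sum_c riemann G (ib c) (fb i B) (ib c) (fb i A) x =
  - (phi i (base_coord x) * metric_trace gB (base_coord x)
       (hessian gB (phi i) (base_coord x)) * gF i (fiber_coord i x) A B).
Proof.
move=> Ux; have [xB xF] := Ux; set z := base_coord x.
rewrite -(divergence_gradient openUB gBP) //; last by move=> ? ?; exact: ddphi.
rewrite -big_split mulr_sumr mulr_suml -sumrN; apply: eq_bigr => c _ /=.
rewrite /riemann.
rewrite (eq_partial_domain _ _ _ _ Ux (fun y => christoffel_b_ff y c i A B)).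
rewrite (eq_partial_domain _ _ _ _ Ux (fun y => christoffel_b_bf y c c i B)) partial_cst subr0.
rewrite (eq_partial _ _ _ _ (fun y => esym (mulNr
  (phi i (base_coord y) * gradient gB (phi i) (base_coord y) ord0 c)
  (gF i (fiber_coord i y) A B)))).
rewrite (partial_base_fiber i
  (fun z => - (phi i z * gradient gB (phi i) z ord0 c)) (fun q => gF i q A B)); last first.
  by apply: derivableN; apply: derivableM; [exact: dphi|exact: derivable_gradient].
rewrite partialN; last by apply: derivableM; [exact: dphi|exact: derivable_gradient].
rewrite partialM; [|exact: dphi|exact: derivable_gradient].
rewrite sum_product_index.
have -> : \sum_d (Gamma (ib c) (ib c) (ib d) x * Gamma (ib d) (fb i A) (fb i B) x
    - Gamma (ib c) (fb i A) (ib d) x * Gamma (ib d) (ib c) (fb i B) x) =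
    - (phi i z * gF i (fiber_coord i x) A B
       * \sum_d christoffel gB c c d z * gradient gB (phi i) z ord0 d).
  rewrite mulr_sumr -sumrN; apply: eq_bigr => d _.
  rewrite christoffel_b_bb // christoffel_b_ff // christoffel_b_fb // -/z.
  by ring.
rewrite (bigD1 i) //= [X in _ + (_ + (_ + X))]big1 ?addr0 => [|j ji]; last first.
  rewrite big1 // => D _.
  by rewrite christoffel_b_bf // christoffel_b_ff0 1?eq_sym // !mul0r subrr.
rewrite (bigD1 B) //= [X in _ + (_ + (_ + X))]big1 ?addr0 => [|D DB]; last first.
  by rewrite christoffel_b_bf // christoffel_f_bf // (negbTE DB) !mul0r mulr0 subrr.
rewrite christoffel_b_bf // christoffel_b_ff // christoffel_f_bf // indicator_refl -/z.
by field; exact: phi_neq0.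
Qed.

(** The last term comes from the product of two mixed Christoffel symbols; summed over [C]
it gives back one copy of the squared norm of the gradient. *)
Lemma ricci_warp_fiber_same x i A B C : U x ->
  riemann G (fb i C) (fb i B) (fb i C) (fb i A) x =
  riemann (gF i) C B C A (fiber_coord i x)
  - (\sum_d gradient gB (phi i) (base_coord x) ord0 d
       * partial d (phi i) (base_coord x)) * gF i (fiber_coord i x) A B
  + (C == A)%:R * (\sum_d gradient gB (phi i) (base_coord x) ord0 d
       * partial d (phi i) (base_coord x)) * gF i (fiber_coord i x) C B.
Proof.
move=> Ux; have [xB xF] := Ux; set z := base_coord x.
rewrite /riemann sum_product_index.
rewrite (eq_partial_domain _ _ _ _ Ux (fun y => christoffel_f_ff y i C A B)).
rewrite (eq_partial_domain _ _ _ _ Ux (fun y => christoffel_f_ff y i C C B)).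
rewrite (partial_fiber i (christoffel (gF i) C A B)).
rewrite (partial_fiber i (christoffel (gF i) C C B)).
rewrite -!addrA; congr (_ + (_ + _)); rewrite [LHS]addrC; congr (_ + _).
  rewrite (bigD1 i) //= [X in _ + X]big1 ?addr0 => [|j ji]; last first.
    by rewrite big1 // => D _; rewrite !(christoffel_f_ff0 x j i i) ?ji // !mulr0 subrr.
  by apply: eq_bigr => D _; rewrite !christoffel_f_ff.
rewrite [(C == A)%:R * _]mulr_sumr !mulr_suml -sumrN -big_split.
apply: eq_bigr => d _ /=.
rewrite !christoffel_f_fb // !christoffel_b_ff // indicator_refl -/z.
by field; exact: phi_neq0.
Qed.

(** Distinct fibers interact only through the base: the single surviving product of
Christoffel symbols pairs the logarithmic gradient of [phi j] with the gradient of
[phi i]. *)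
Lemma ricci_warp_fiber_diff x i j A B C : U x -> j != i ->
  riemann G (fb j C) (fb i B) (fb j C) (fb i A) x =
  - (phi i (base_coord x) / phi j (base_coord x) *
     (\sum_d gradient gB (phi i) (base_coord x) ord0 d
       * partial d (phi j) (base_coord x)) * gF i (fiber_coord i x) A B).
Proof.
move=> Ux ji; have [xB xF] := Ux; set z := base_coord x.
rewrite /riemann sum_product_index.
have ji' : (j != i) || (j != i) by rewrite ji.
have ji'' : (j != j) || (j != i) by rewrite ji orbT.
rewrite (eq_partial_domain _ _ _ _ Ux (fun y Uy => christoffel_f_ff0 y j i i C A B Uy ji')).
rewrite (eq_partial_domain _ _ _ _ Ux (fun y Uy => christoffel_f_ff0 y j j i C C B Uy ji'')).
rewrite !partial_cst subrr add0r [X in _ + X]big1 ?addr0 => [|k _].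
  rewrite mulr_sumr mulr_suml -sumrN; apply: eq_bigr => d _.
  rewrite !christoffel_f_fb // christoffel_f_fb0 // christoffel_b_ff // indicator_refl -/z.
  by field; exact: phi_neq0.
rewrite big1 // => D _.
rewrite (christoffel_f_ff0 x j i k) ?ji // mul0r subr0.
case: (eqVneq k i) => [ki|ki].
  by rewrite (christoffel_f_ff0 x j j k) ?mul0r // ki ji orbT.
by rewrite (christoffel_f_ff0 x k i i) ?ki ?mulr0.
Qed.

Lemma ricci_warp_fiber x i A B : U x ->
  ricci G x (fb i A) (fb i B) = ricci (gF i) (fiber_coord i x) A B
  - fiber_ricci_shift i (base_coord x) * gF i (fiber_coord i x) A B.
Proof.
move=> Ux; have [xB xF] := Ux; set z := base_coord x.
rewrite !mxE sum_product_index ricci_warp_fiber_base // -/z.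
pose q k := \sum_d gradient gB (phi i) z ord0 d * partial d (phi k) z.
have -> : \sum_j \sum_C riemann G (fb j C) (fb i B) (fb j C) (fb i A) x =
    \sum_j (if j == i then \sum_C riemann (gF i) C B C A (fiber_coord i x)
                           + q i * gF i (fiber_coord i x) A B else 0)
    - \sum_j (s j)%:R * (phi i z / phi j z * q j * gF i (fiber_coord i x) A B).
  rewrite -sumrB; apply: eq_bigr => j _.
  case: (eqVneq j i) => [->|ji]; last first.
    rewrite (eq_bigr _ (fun C _ => ricci_warp_fiber_diff x i j A B C Ux ji)).
    by rewrite sumr_const card_ord -[in LHS]mulr_natl mulrN sub0r.
  rewrite (eq_bigr _ (fun C _ => ricci_warp_fiber_same x i A B C Ux)).
  rewrite big_split sumrB /= -addrA -[RHS]addrA; congr (_ + _).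
  rewrite sumr_const card_ord -[in LHS]mulr_natl addrC; congr (_ - _).
    rewrite (bigD1 A) //= indicator_refl mul1r [X in _ + X]big1 ?addr0 // => C CA.
    by rewrite (negbTE CA) !mul0r.
  by rewrite mulfV ?mul1r // phi_neq0.
rewrite -big_mkcond big_pred1_eq /fiber_ricci_shift -/(q i).
have -> : \sum_j (s j)%:R * (phi i z / phi j z * q j * gF i (fiber_coord i x) A B) =
    phi i z * (\sum_k (s k)%:R / phi k z * q k) * gF i (fiber_coord i x) A B.
  by rewrite mulr_sumr mulr_suml; apply: eq_bigr => j _; ring.
by ring.
Qed.

Lemma metric_trace_warp x (T : 'M[R]_N) : U x ->
  metric_trace G x T =
  metric_trace gB (base_coord x) (\matrix_(a, b) T (ib a) (ib b))
  + \sum_i (phi i (base_coord x) ^+ 2)^-1 *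
      metric_trace (gF i) (fiber_coord i x) (\matrix_(A, B) T (fb i A) (fb i B)).
Proof.
move=> Ux; rewrite /metric_trace /mxtrace sum_product_index; congr (_ + _).
  apply: eq_bigr => a _; rewrite !mxE (invmx_warp_metric_b (fun l => T l (ib a))) //.
  by apply: eq_bigr => b _; rewrite mxE.
apply: eq_bigr => i _; rewrite mulr_sumr; apply: eq_bigr => A _.
rewrite !mxE (invmx_warp_metric_f (fun l => T l (fb i A))) //; congr (_ * _).
by apply: eq_bigr => B _; rewrite mxE.
Qed.


(** The hypothesis on the base block is what condition ( * ) and the Einstein equation of
the product have in common. *)
Lemma metric_trace_warp_ricci x (l : R) : U x ->
  \matrix_(a, b) ricci G x (ib a) (ib b) = l *: gB (base_coord x) ->
  metric_trace G x (ricci G x) = l * n%:R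
  + \sum_i (phi i (base_coord x) ^+ 2)^-1 *
      (metric_trace (gF i) (fiber_coord i x) (ricci (gF i) (fiber_coord i x))
       - (s i)%:R * fiber_ricci_shift i (base_coord x)).
Proof.
move=> Ux Ric; have [xB xF] := Ux; rewrite metric_trace_warp // Ric; congr (_ + _).
  by rewrite /metric_trace -scalemxAr linearZ /= mulVmx ?(local_unit _ _ gBP) // mxtrace1.
apply: eq_bigr => i _; congr (_ * _).
have -> : \matrix_(A, B) ricci G x (fb i A) (fb i B) = ricci (gF i) (fiber_coord i x)
    - fiber_ricci_shift i (base_coord x) *: gF i (fiber_coord i x).
  apply/matrixP => A B; rewrite mxE ricci_warp_fiber // [in RHS]mxE.
  by congr (_ + _); rewrite !mxE.
rewrite /metric_trace mulmxBr linearB /= -scalemxAr linearZ /=.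
by rewrite mulVmx ?(local_unit _ _ (gFP i)) // mxtrace1 mulrC.
Qed.

End WarpedMetric.

(** * The geometry of a chart, and the theorem *)

Section ChartMetric.
Context {R : realType} {n : nat} {M : charted_metric R n} (MP : semi_riemannian M).
Implicit Types (c : chart M) (p : M) (f : M -> R).

Lemma chart_local_metric c : local_metric (chart_image c) (metric c).
Proof.
split=> [y|y|y yc i j k]; [exact: (Defs.metric_sym MP)|exact: (metric_unit MP)|].
by have [_ /(_ k) [+ _]] := smooth_metric MP c i j 1; apply.
Qed.

Lemma open_chart c : open (chart_image c).
Proof. exact: open_chart_image (semi_riemannian_manifold MP) c. Qed.

Lemma mem_chart_image p : chart_image (chart_at p) (Defs.coord (chart_at p) p).
Proof. by exists p => //; exact: mem_chart_at (semi_riemannian_manifold MP) p. Qed.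

Lemma paramK p : param (chart_at p) (Defs.coord (chart_at p) p) = p.
Proof.
apply: coordK (semi_riemannian_manifold MP) _ _ _.
exact: mem_chart_at (semi_riemannian_manifold MP) p.
Qed.

End ChartMetric.

Theorem corollary4p9 (R : realType) (m n : nat) (s : 'I_m -> nat)
  (B : charted_metric R n) (F : forall i : 'I_m, charted_metric R (s i))
  (b : 'I_m -> B -> R) (lambda : B -> R) (mu : 'I_m -> R)
  (B_semi_riemannian : semi_riemannian B)
  (F_semi_riemannian : forall i, semi_riemannian (F i))
  (b_smooth : forall i, smooth_function (b i))
  (b_gt0 : forall i p, 0 < b i p)
  (F_einstein : forall i, einstein (F i))
  (F_scalar : forall i (q : F i), scalar_curvature q = (s i)%:R * mu i)
  (lambda_smooth : smooth_function lambda) :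
  let M := warped_product F b in
  let N : R := n%:R + \sum_i (s i)%:R in
  let S := fun p : B =>
    \sum_i (s i)%:R * (b i p ^+ 2)^-1 * fiber_defect s b lambda mu i p in
  [/\ base_ricci_condition s b lambda ->
        forall p : M, S p.1 = lambda p.1 * N - scalar_curvature p,
      (forall p : M, scalar_curvature p = lambda p.1 * N) ->
        base_ricci_condition s b lambda ->
        forall p : M, S p.1 = 0
    & @ricci_proportional R _ M (fun p : M => lambda p.1) ->
        forall p : M, S p.1 = 0].
Proof.
move=> M N S.
pose cB (p : M) := chart_at p.1; pose cF (p : M) i := chart_at (p.2 i).
pose phi (p : M) i := b i \o param (cB p).
pose G (p : M) := warp_metric (metric (cB p)) (fun i => metric (cF p i)) (phi p).
pose x (p : M) : 'rV[R]_(n + \sum_i s i) := Defs.coord (chart_at p) p.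
have GE p : metric (chart_at p) = G p by [].
have xB p : base_coord (x p) = Defs.coord (cB p) p.1 by exact: row_mxKl.
have xF p i : fiber_coord i (x p) = Defs.coord (cF p i) (p.2 i).
  by rewrite /fiber_coord row_mxKr mxrowK.
have openB p := open_chart B_semi_riemannian (cB p).
have openF p i := open_chart (F_semi_riemannian i) (cF p i).
have BP p := chart_local_metric B_semi_riemannian (cB p).
have FP p i := chart_local_metric (F_semi_riemannian i) (cF p i).
have phi0 p i z : chart_image (cB p) z -> phi p i z != 0.
  by move=> _; rewrite gt_eqF //; exact: b_gt0.
have dphi p i a z : chart_image (cB p) z -> derivable (phi p i) z (delta_mx ord0 a).
  by move=> zB; have [_ /(_ a) [+ _]] := b_smooth i (cB p) 1; apply.
have ddphi p i a d z : chart_image (cB p) z ->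
    derivable (partial a (phi p i)) z (delta_mx ord0 d).
  move=> zB; have [_ /(_ a) [_ [_ /(_ d) [+ _]]]] := b_smooth i (cB p) 2.
  by apply.
have Ux p : warp_domain (chart_image (cB p)) (fun i => chart_image (cF p i)) (x p).
  split; first by rewrite xB; exact: mem_chart_image.
  by move=> i; rewrite xF; exact: mem_chart_image.
have phiE p i : phi p i (base_coord (x p)) = b i p.1.
  by rewrite xB /phi /= (paramK B_semi_riemannian).
pose K (p : M) i := fiber_ricci_shift (s := s) (metric (cB p)) (phi p) i (base_coord (x p)).
have gradE p i k : \sum_c gradient (metric (cB p)) (phi p i) (base_coord (x p)) ord0 c
      * partial c (phi p k) (base_coord (x p)) =
    inner (metric (cB p)) (base_coord (x p))
      (gradient (metric (cB p)) (phi p i) (base_coord (x p)))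
      (gradient (metric (cB p)) (phi p k) (base_coord (x p))).
  by rewrite (inner_gradient (BP p)) //; case: (Ux p).
have defectE p i : fiber_defect s b lambda mu i p.1 =
    K p i + b i p.1 ^+ 2 * lambda p.1 - mu i.
  have bp0 k : b k p.1 != 0 by rewrite gt_eqF.
  rewrite /fiber_defect /K /fiber_ricci_shift phiE gradE.
  have -> : \sum_k (s k)%:R / phi p k (base_coord (x p)) * \sum_c
        gradient (metric (cB p)) (phi p i) (base_coord (x p)) ord0 c
        * partial c (phi p k) (base_coord (x p)) =
      b i p.1 * \sum_k (s k)%:R * log_grad_inner (b i) (b k) p.1.
    rewrite mulr_sumr; apply: eq_bigr => k _; rewrite phiE gradE xB.
    rewrite /log_grad_inner /inner linearZ /= -!scalemxAl -scalemxAr !mxE.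
    rewrite /gradient_at /phi /cB; field.
    by rewrite !bp0.
  rewrite xB /laplacian /grad_sqnorm /hessian_at /gradient_at /phi /cB.
  by field; rewrite bp0.
have main p : \matrix_(a, d) ricci (G p) (x p) (base_index a) (base_index d) =
    lambda p.1 *: metric (cB p) (base_coord (x p)) ->
    S p.1 = lambda p.1 * N - scalar_curvature p.
  move=> Ric; rewrite /scalar_curvature GE.
  rewrite /ricci_at GE -/(x p).
  rewrite (metric_trace_warp_ricci _ _ _ _ _ (openB p) (openF p) (BP p) (FP p)
    (phi0 p) (dphi p) (ddphi p) _ _ (Ux p) Ric).
  rewrite /S /N mulrDr opprD addrACA subrr add0r mulr_sumr -sumrB.
  apply: eq_bigr => i _; rewrite defectE -/(K p i) phiE xF.
  have := F_scalar i (p.2 i); rewrite /scalar_curvature /ricci_at => ->.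
  by field; rewrite gt_eqF.
have base p a d : ricci (G p) (x p) (base_index a) (base_index d) =
    ricci_at (cB p) p.1 a d
    - \sum_i (s i)%:R / b i p.1 * hessian_at (cB p) (b i) p.1 a d.
  rewrite (ricci_warp_base _ _ _ _ _ (openB p) (openF p) (BP p) (FP p)
    (phi0 p) (dphi p) (ddphi p) _ _ _ (Ux p)) xB; congr (_ - _).
  by apply: eq_bigr => i _; rewrite -xB phiE xB.
have trace_identity : base_ricci_condition s b lambda ->
    forall p : M, S p.1 = lambda p.1 * N - scalar_curvature p.
  move=> Ric p; apply: main; apply/matrixP => a d; rewrite mxE base.
  rewrite Ric; last exact: mem_chart_at (semi_riemannian_manifold B_semi_riemannian) _.
  rewrite xB mxE summxE [X in _ + X - _](eq_bigr (fun i =>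
    (s i)%:R / b i p.1 * hessian_at (cB p) (b i) p.1 a d)) ?addrK // => i _.
  by rewrite mxE.
split => // [tau Ric p|Ein p]; first by rewrite trace_identity // tau subrr.
have Rp : ricci (G p) (x p) = lambda p.1 *: G p (x p).
  apply: (Ein (chart_at p) p).
  by split; [|move=> i]; exact: mem_chart_at (semi_riemannian_manifold _) _.
rewrite main.
  rewrite /scalar_curvature /ricci_at GE -/(x p) Rp.
  rewrite /metric_trace -scalemxAr linearZ /= mulVmx ?mxtrace1 ?natrD ?natr_sum ?subrr //.
  exact: (warp_metric_unit _ _ _ _ _ (BP p) (FP p) (phi0 p) _ (Ux p)).
apply/matrixP => a d; rewrite mxE Rp mxE [RHS]mxE.
by rewrite (warp_metric_bb _ _ _ (x p)).
Qed.
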